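(* Let $G$ be a compactly generated locally compact metabelian group and $(N_n)_{n\ge0}$ an ascending sequence of closed normal subgroups of $G$. Let $N=\overline{\bigcup_n N_n}$. Then there exists $n_0$ such that $N_n$ is cocompact in $N$ for all $n\ge n_0$.
   Context: A locally compact group is metabelian if its derived subgroup $[G,G]$ is abelian. Compactly generated means generated as an abstract group by a compact subset. *)

(* Defs.v *)
From HB Require Import structures.
From mathcomp Require Import all_boot all_order.
From mathcomp Require Import all_classical.
From mathcomp Require Import topology.

Set Implicit Arguments.
Unset Strict Implicit.
Unset Printing Implicit Defensive.

Local Open Scope classical_set_scope.
Local Open Scope group_scope.

HB.mixin Record Group_isTopological G of Group G & Topological G := {
  mulg_continuous : continuous (fun p : G * G => p.1 * p.2);
  invg_continuous : continuous (fun x : G => x^-1)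
}.

#[short(type="topGroupType")]
HB.structure Definition TopGroup :=
  {G of Group_isTopological G & Group G & Topological G}.

Section TopGroupDefs.
Variable G : topGroupType.

Definition is_subgroup (H : set G) : Prop :=
  [/\ H 1, (forall x y, H x -> H y -> H (x * y)) & (forall x, H x -> H x^-1)].

Definition is_normal_subgroup (H : set G) : Prop :=
  is_subgroup H /\ (forall x g, H x -> H (x ^ g)).

Definition is_closed_normal_subgroup (H : set G) : Prop :=
  is_normal_subgroup H /\ closed H.

Definition generated_subgroup (A : set G) : set G :=
  [set x | forall H : set G, is_subgroup H -> A `<=` H -> H x].

Definition derived_subgroup : set G :=
  generated_subgroup [set [~ x, y] | x in [set: G] & y in [set: G]].

Definition metabelian : Prop :=
  forall x y, derived_subgroup x -> derived_subgroup y -> x * y = y * x.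

Definition locally_compact_group : Prop :=
  hausdorff_space G /\ forall x : G, exists K : set G, nbhs x K /\ compact K.

Definition compactly_generated : Prop :=
  exists K : set G, compact K /\ generated_subgroup K = [set: G].

Definition cocompact_in (H N : set G) : Prop :=
  exists K : set G, compact K /\ N = [set k * h | k in K & h in H].

End TopGroupDefs.

(* Main.v *)
Require Import Defs.
From HB Require Import structures.
From mathcomp Require Import all_boot all_order.
From mathcomp Require Import all_classical.
From mathcomp Require Import topology.

Set Implicit Arguments.
Unset Strict Implicit.
Unset Printing Implicit Defensive.

(**
  Suppose that [N] is generated by a compact set under multiplication and
  conjugation by a finite set [T].  Then finitely many elements of the dense
  union of the [N_n] generate [N] modulo a compact neighbourhood [U] of [1] in
  [N]: choose a finite set [F] in that union such that [U F] contains [U U], the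
  conjugates of [U] by [T] and the compact generators; as soon as [F <= N_n],
  the set [U N_n] is a subgroup stable under [T], hence is all of [N].  It thus
  suffices that every closed normal subgroup of [G] be generated in this way.

  There is a finite set [T] with [G = S <T>], [S] compact, and
  [A = closure [G, G]] is a compactly generated module over <T>, which acts on
  it through an abelian group.  Closed submodules of such modules are compactly
  generated by Hilbert's basis argument, inducting on the number of acting
  generators: the modules of leading coefficients are open, so the increasing
  sequence they form stabilizes.  The induction starts with closed subgroups of
  compactly generated abelian groups.  This handles [N :&: A].  As [N] is
  central modulo [N :&: A], the closure of [N A] is abelian modulo [N :&: A],
  and the same argument applied to it handles [N / (N :&: A)].
*)

Local Open Scope classical_set_scope.
Local Open Scope group_scope.

Section CommutatorIdentities.
Variable G : groupType.
Implicit Types x y z : G.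

Lemma commMgJ x y z : [~ x * y, z] = [~ x, z] ^ y * [~ y, z].
Proof. by rewrite !commgEr conjgM mulgA -conjMg mulgK. Qed.

Lemma commgMJ x y z : [~ x, y * z] = [~ x, z] * [~ x, y] ^ z.
Proof. by rewrite !commgEl conjgM -mulgA -conjMg mulVKg. Qed.

Lemma commVgJ x y : [~ x^-1, y] = [~ x, y]^-1 ^ x^-1.
Proof. by rewrite invgR !commgEl !conjgE !invgK !mulgA !mulgK. Qed.

Lemma conjg_mulR x y : x ^ y = x * [~ x, y].
Proof. by rewrite commgEl mulVKg. Qed.

End CommutatorIdentities.

Lemma near_finite_forall (T : Type) (I : choiceType) (F : set_system T)
    (J : set I) (P : I -> T -> Prop) : Filter F -> finite_set J ->
  (forall i, J i -> \forall x \near F, P i x) ->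
  \forall x \near F, forall i, J i -> P i x.
Proof. by move=> FF /finite_fsetP[K ->] /(filter_bigI FF). Qed.

Lemma subset_homo (T : Type) (A : nat -> set T) :
  (forall n, A n `<=` A n.+1) -> {homo A : m n / (m <= n)%N >-> m `<=` n}.
Proof.
by apply: homo_leq => [B|B C D]; [exact: subset_refl|exact: subset_trans].
Qed.

Lemma near_finite_subset (T : choiceType) (F : set T) (A : nat -> set T) :
  {homo A : m n / (m <= n)%N >-> m `<=` n} -> finite_set F ->
  F `<=` \bigcup_n A n -> \forall n \near \oo, F `<=` A n.
Proof.
move=> A_mono fF FA; apply: near_finite_forall => // x /FA[m _ Amx].
by exists m => // n /= mn; exact: A_mono Amx.
Qed.

Lemma finite_set_ind (T : eqType) (P : set T -> Prop) : P set0 ->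
  (forall x A, finite_set A -> P A -> P (x |` A)) ->
  forall A, finite_set A -> P A.
Proof.
move=> P0 PU A /finite_seqP[s ->].
elim: s => [|x s Ps]; first by rewrite set_nil.
have -> : [set` x :: s] = x |` [set` s].
  by apply/seteqP; split=> y /=; rewrite inE => /predU1P.
by apply: PU => //; exact: finite_seq.
Qed.

Lemma closure_min (T : topologicalType) (D N : set T) :
  closed N -> D `<=` N -> closure D `<=` N.
Proof. by move=> clN /closureS /subset_trans; exact. Qed.

Lemma closure_subset_preimage (S T : topologicalType) (f : S -> T)
    (D : set S) (N : set T) : continuous f -> closed N ->
  (forall x, D x -> N (f x)) -> forall x, closure D x -> N (f x).
Proof.
move=> cf clN DN; apply: closure_min => //.
by apply: (continuous_closedP f).1.
Qed.

Lemma compact_image (S T : topologicalType) (f : S -> T) (K : set S) :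
  continuous f -> compact K -> compact (f @` K).
Proof.
by move=> cf; apply: continuous_compact; exact: continuous_subspaceT.
Qed.

Lemma compact_image2 (R S T : topologicalType) (f : R -> S -> T) (K : set R)
    (M : set S) :
  continuous (fun p : R * S => f p.1 p.2) -> compact K -> compact M ->
  compact [set f x y | x in K & y in M].
Proof.
move=> cf cK cM; rewrite image2E.
have -> : uncurry f = fun p => f p.1 p.2 by apply/funext => -[].
apply: continuous_compact (compact_setX cK cM); exact: continuous_subspaceT.
Qed.

Section SetProducts.
Variable G : groupType.
Implicit Types (a b : G) (A B C F : set G).

Definition mulset A B : set G := [set a * b | a in A & b in B].

Lemma mulsetM A B a b : A a -> B b -> mulset A B (a * b).
Proof. by move=> Aa Bb; exists a => //; exists b. Qed.

Lemma mulsetS A A' B B' : A `<=` A' -> B `<=` B' ->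
  mulset A B `<=` mulset A' B'.
Proof. by move=> AA' BB' _ [a /AA' A'a [b /BB' B'b <-]]; exact: mulsetM. Qed.

Lemma subset_mulsetl A B : B 1 -> A `<=` mulset A B.
Proof. by move=> B1 a Aa; rewrite -[a]mulg1; exact: mulsetM. Qed.

Lemma subset_mulsetr A B : A 1 -> B `<=` mulset A B.
Proof. by move=> A1 b Bb; rewrite -[b]mul1g; exact: mulsetM. Qed.

Lemma mulsetA A B C : mulset A (mulset B C) = mulset (mulset A B) C.
Proof.
apply/seteqP; split=> [_ [a Aa [_ [b Bb [c Cc <-]] <-]]|].
  by rewrite mulgA; apply: mulsetM => //; exact: mulsetM.
move=> _ [_ [a Aa [b Bb <-]] [c Cc <-]].
by rewrite -mulgA; apply: mulsetM => //; exact: mulsetM.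
Qed.

Lemma finite_subset_mulset A B F : finite_set F -> F `<=` mulset A B ->
  exists F', [/\ finite_set F', F' `<=` B & F `<=` mulset A F'].
Proof.
move=> fF FAB.
have /choice[h Fh] f : exists b, F f -> B b /\ exists2 a, A a & a * b = f.
  have [/FAB[a Aa [b Bb E]]|nFf] := pselect (F f); last by exists 1.
  by exists b => _; split=> //; exists a.
exists (h @` F); split; first exact: finite_image.
  by move=> _ [f /Fh[Bhf _] <-].
by move=> f Ff; have [_ [a Aa <-]] := Fh f Ff; apply: mulsetM => //; exists f.
Qed.

Definition symm A : set G := A `|` [set a^-1 | a in A].

Lemma symm_subset A : A `<=` symm A.
Proof. by move=> a; left. Qed.

Lemma symmV A a : symm A a -> symm A a^-1.
Proof. by move=> [Aa|[b Ab <-]]; [right; exists a|left; rewrite invgK]. Qed.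

End SetProducts.

Section TopologicalGroups.
Variable G : topGroupType.
Implicit Types (x y g : G) (C D K M U V : set G).

Lemma cvgMg (T : Type) (F : set_system T) (FF : Filter F) (f h : T -> G) x y :
  f @ F --> x -> h @ F --> y -> (fun t => f t * h t) @ F --> x * y.
Proof. by apply: continuous2_cvg; exact: (mulg_continuous (x, y)). Qed.

Lemma cvgVg (T : Type) (F : set_system T) (FF : Filter F) (f : T -> G) x :
  f @ F --> x -> (fun t => (f t)^-1) @ F --> x^-1.
Proof. by move=> fx; apply: cvg_comp fx _; exact: invg_continuous. Qed.

Lemma cvgJg (T : Type) (F : set_system T) (FF : Filter F) (f h : T -> G) x y :
  f @ F --> x -> h @ F --> y -> (fun t => f t ^ h t) @ F --> x ^ y.
Proof. by move=> fx hy; apply: cvgMg; [exact: cvgVg|exact: cvgMg]. Qed.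

Lemma cvgRg (T : Type) (F : set_system T) (FF : Filter F) (f h : T -> G) x y :
  f @ F --> x -> h @ F --> y -> (fun t => [~ f t, h t]) @ F --> [~ x, y].
Proof. by move=> fx hy; apply: cvgMg; [exact: cvgVg|exact: cvgJg]. Qed.

Lemma mulgr_continuous x : continuous (fun y => x * y).
Proof. by move=> y; apply: cvgMg; [exact: cvg_cst|exact: cvg_id]. Qed.

Lemma mulgl_continuous y : continuous (fun x => x * y).
Proof. by move=> x; apply: cvgMg; [exact: cvg_id|exact: cvg_cst]. Qed.

Lemma conjg_continuous g : continuous (fun x => x ^ g).
Proof. by move=> x; apply: cvgJg; [exact: cvg_id|exact: cvg_cst]. Qed.

Lemma nbhs1_conjg V g : nbhs (1 : G) V -> nbhs (1 : G) [set x | V (x ^ g)].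
Proof. by move=> V1; apply: conjg_continuous; rewrite conj1g. Qed.

Lemma nbhs1_split V : nbhs (1 : G) V ->
  exists U, [/\ nbhs (1 : G) U, forall x, U x -> U x^-1 &
    forall x y, U x -> U y -> V (x * y)].
Proof.
move=> V1; have : nbhs ((1, 1) : G * G) [set p | V (p.1 * p.2)].
  by apply: (@mulg_continuous G (1, 1)); rewrite /= mulg1.
case=> -[U1 U2] [/= nU1 nU2] UV; pose U := U1 `&` U2.
exists (U `&` [set x | U x^-1]); split.
- apply: filterI; first exact: filterI.
  by apply: (@invg_continuous G 1); rewrite invg1; exact: filterI.
- by move=> x [Ux UVx]; split=> //=; rewrite invgK.
- by move=> x y [[Ux _] _] [[_ Uy] _]; exact: (UV (x, y)).
Qed.

Lemma closure_div_nbhs1 D V x : closure D x -> nbhs (1 : G) V ->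
  exists2 d, D d & V (x / d).
Proof.
move=> clDx V1; have xV : nbhs x [set y | V (x / y)].
  have div_cvg : (fun y => x / y) @ x --> x / x.
    by apply: cvgMg; [exact: cvg_cst|exact: invg_continuous].
  by apply: div_cvg; rewrite mulgV.
by have [d [Dd Vd]] := clDx _ xV; exists d.
Qed.

Lemma compact_mulset K M : compact K -> compact M -> compact (mulset K M).
Proof. by apply: compact_image2; exact: mulg_continuous. Qed.

Lemma compact_symm K : compact K -> compact (symm K).
Proof.
by move=> cK; apply: compactU => //; apply: compact_image => //;
  exact: invg_continuous.
Qed.

Lemma compact_conjg K M : compact K -> compact M ->
  compact [set x ^ g | x in K & g in M].
Proof.
by apply: compact_image2 => p; apply: cvgJg; [exact: cvg_fst|exact: cvg_snd].
Qed.

Lemma compact_commg K M : compact K -> compact M ->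
  compact [set [~ x, y] | x in K & y in M].
Proof.
by apply: compact_image2 => p; apply: cvgRg; [exact: cvg_fst|exact: cvg_snd].
Qed.

Lemma compact_subset_mulset C D V : compact C -> C `<=` closure D ->
  nbhs (1 : G) V ->
  exists F, [/\ finite_set F, F `<=` D & C `<=` mulset V F].
Proof.
move=> cC CD V1.
pose finite_subsets := [set F : set G | finite_set F /\ F `<=` D].
pose supersets F0 := [set F | finite_subsets F /\ F0 `<=` F].
have FF : Filter (filter_from finite_subsets supersets).
  apply: filter_from_filter; first by exists set0; split.
  move=> F1 F2 [fF1 F1D] [fF2 F2D]; exists (F1 `|` F2).
    by split; [rewrite finite_setU|rewrite subUset].
  by move=> F [fsF]; rewrite subUset => -[F1F F2F]; split.
have [c Cc|F0 [fF0 F0D] coverF0] :=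
    (compact_near_coveringP C).1 cC _ _ (fun F c => mulset V F c) FF.
  have [d Dd Vcd] := closure_div_nbhs1 (CD c Cc) (nbhs_interior V1).
  exists ([set y | V (y / d)], supersets [set d]).
    split=> /=; first exact: (@mulgl_continuous d^-1 c).
    by exists [set d] => //; split; [exact: finite_set1|move=> _ ->].
  move=> [y F] /= [Vyd [_ dF]]; rewrite -[y](mulgVK d).
  by apply: mulsetM => //; exact: dF.
by exists F0; split=> // c; apply: coverF0; split.
Qed.

End TopologicalGroups.

Section Subgroups.
Variable G : topGroupType.
Implicit Types (x y z g : G) (A B H M N T V X Y : set G).

Lemma subgroup1 H : is_subgroup H -> H 1.
Proof. by case. Qed.

Lemma subgroupM H x y : is_subgroup H -> H x -> H y -> H (x * y).
Proof. by case=> _ + _; exact. Qed.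

Lemma subgroupV H x : is_subgroup H -> H x -> H x^-1.
Proof. by case=> _ _; exact. Qed.

Lemma subgroupX H x n : is_subgroup H -> H x -> H (x ^+ n).
Proof.
move=> sH Hx; elim: n => [|n IHn]; first exact: subgroup1.
by rewrite expgS; exact: subgroupM.
Qed.

Lemma subgroup_div H x y : is_subgroup H -> H x -> H y -> H (x / y).
Proof. by move=> sH Hx Hy; apply: subgroupM => //; exact: subgroupV. Qed.

Lemma subgroup_cancelr H x y : is_subgroup H -> H y -> H (x * y) -> H x.
Proof. by move=> sH Hy Hxy; rewrite -[x](mulgK y); exact: subgroup_div. Qed.

Lemma subgroup_cancell H x y : is_subgroup H -> H x -> H (x * y) -> H y.
Proof.
by move=> sH Hx Hxy; rewrite -[y](mulKg x); apply: subgroupM => //;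
  exact: subgroupV.
Qed.

Lemma symm_subset_subgroup A H : is_subgroup H -> A `<=` H -> symm A `<=` H.
Proof. by move=> sH AH _ [/AH//|[a /AH Ha <-]]; exact: subgroupV. Qed.

Lemma subgroup_setT : is_subgroup [set: G].
Proof. by split. Qed.

Lemma subgroup_set1 : is_subgroup [set (1 : G)].
Proof. by split=> [//|x y -> ->|x ->] /=; rewrite ?mulg1 ?invg1. Qed.

Lemma subgroup_sub1set H : is_subgroup H -> [set 1] `<=` H.
Proof. by move=> /subgroup1 H1 _ ->. Qed.

Lemma subgroup_setI A B :
  is_subgroup A -> is_subgroup B -> is_subgroup (A `&` B).
Proof.
move=> sA sB; split; first by split; exact: subgroup1.
  by move=> x y [? ?] [? ?]; split; exact: subgroupM.
by move=> x [? ?]; split; exact: subgroupV.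
Qed.

Lemma subgroup_bigcup (N_ : nat -> set G) :
  {homo N_ : m n / (m <= n)%N >-> m `<=` n} ->
  (forall n, is_subgroup (N_ n)) -> is_subgroup (\bigcup_n N_ n).
Proof.
move=> N_mono sN; split; first by exists 0%N => //; exact: subgroup1.
  move=> x y [m _ Nx] [n _ Ny]; exists (maxn m n) => //.
  by apply: subgroupM => //; [apply: N_mono Nx; exact: leq_maxl|
    apply: N_mono Ny; exact: leq_maxr].
by move=> x [n _ Nx]; exists n => //; exact: subgroupV.
Qed.

Lemma subgroup_closure A : is_subgroup A -> is_subgroup (closure A).
Proof.
move=> sA; have cl := @closed_closure _ A; split.
- by apply: subset_closure; exact: subgroup1.
- move=> x y Ax Ay.
  apply: (closure_subset_preimage (@mulgl_continuous _ y) cl) Ax => {}x Ax.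
  apply: (closure_subset_preimage (@mulgr_continuous _ x) cl) Ay => {}y Ay.
  by apply: subset_closure; exact: subgroupM.
- apply: closure_subset_preimage => // [|x Ax]; first exact: invg_continuous.
  by apply: subset_closure; exact: subgroupV.
Qed.

Lemma closure_normal_subgroup A :
  is_normal_subgroup A -> is_normal_subgroup (closure A).
Proof.
move=> [sA nA]; split=> [|x g]; first exact: subgroup_closure.
apply: (closure_subset_preimage (@conjg_continuous _ g)) => [|y Ay].
  exact: closed_closure.
by apply: subset_closure; exact: nA.
Qed.

Lemma normal_set1 : is_normal_subgroup [set (1 : G)].
Proof. by split; [exact: subgroup_set1|move=> _ g ->; rewrite /= conj1g]. Qed.

Lemma normal_setI M N : is_normal_subgroup M -> is_normal_subgroup N ->
  is_normal_subgroup (M `&` N).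
Proof.
move=> [sM nM] [sN nN]; split; first exact: subgroup_setI.
by move=> x g [Mx Nx]; split; [exact: nM|exact: nN].
Qed.

Lemma relatively_open_subgroup_closed N M V : closed N -> is_subgroup N ->
  is_subgroup M -> M `<=` N -> nbhs (1 : G) V -> V `&` N `<=` M -> closed M.
Proof.
move=> clN sN sM MN V1 VM x clMx.
have Nx : N x by apply: clN; exact: closureS clMx.
have [m Mm Vm] := closure_div_nbhs1 clMx V1.
apply: (subgroup_cancelr sM (subgroupV sM Mm)); apply: VM; split=> //.
by apply: subgroup_div => //; exact: MN.
Qed.

Definition conj_stable T M :=
  forall g x, T g -> M x -> M (x ^ g) /\ M (x ^ g^-1).

Lemma conj_stableJ T M x g : conj_stable T M -> M x -> T g -> M (x ^ g).
Proof. by move=> tM Mx Tg; case: (tM g x). Qed.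

Lemma conj_stableX T M x g n :
  conj_stable T M -> M x -> T g -> M (x ^ (g ^+ n)).
Proof.
move=> tM Mx Tg; elim: n => [|n IHn]; first by rewrite conjg1.
by rewrite expgSr conjgM; exact: conj_stableJ Tg.
Qed.

Lemma conj_stableXV T M x g n :
  conj_stable T M -> T g -> M (x ^ (g ^+ n)) -> M x.
Proof.
move=> tM Tg; elim: n => [|n IHn]; first by rewrite conjg1.
rewrite expgSr conjgM => Mx; apply: IHn.
by rewrite -[x ^ _](conjgK g); exact: (tM g _ Tg Mx).2.
Qed.

Lemma conj_stableS T T' M : T `<=` T' -> conj_stable T' M -> conj_stable T M.
Proof. by move=> TT' tM g x /TT'; exact: tM. Qed.

Lemma conj_stableU T T' M :
  conj_stable T M -> conj_stable T' M -> conj_stable (T `|` T') M.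
Proof. by move=> tM t'M g x [/tM|/t'M]; exact. Qed.

Lemma conj_stable0 M : conj_stable set0 M.
Proof. by []. Qed.

Lemma conj_stable_subgroup A M : is_subgroup A ->
  (forall x g, M x -> A g -> M (x ^ g)) -> conj_stable A M.
Proof. by move=> sA AM g x Ag Mx; split; apply: AM => //; exact: subgroupV. Qed.

Lemma conj_stable_refl M : is_subgroup M -> conj_stable M M.
Proof.
move=> sM; apply: conj_stable_subgroup => // x g Mx Mg.
by apply: subgroupM; [|exact: subgroupV|exact: subgroupM].
Qed.

Lemma normal_conj_stable T M : is_normal_subgroup M -> conj_stable T M.
Proof. by move=> [_ nM] g x _ Mx; split; exact: nM. Qed.

Lemma conj_stable_setI T M N :
  conj_stable T M -> conj_stable T N -> conj_stable T (M `&` N).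
Proof. by move=> tM tN g x Tg [/(tM g _ Tg)[? ?] /(tN g _ Tg)[? ?]]. Qed.

Lemma conj_stable_mulset T M N :
  conj_stable T M -> conj_stable T N -> conj_stable T (mulset M N).
Proof.
move=> tM tN g _ Tg [m /(tM g _ Tg)[? ?] [n /(tN g _ Tg)[? ?] <-]].
by rewrite !conjMg; split; exact: mulsetM.
Qed.

(* The hypotheses on [A] are those of a subgroup modulo [M]. *)
Lemma subgroup_mulset_mod A M : A 1 -> (forall a, A a -> A a^-1) ->
  mulset A A `<=` mulset A M -> is_subgroup M -> conj_stable A M ->
  is_subgroup (mulset A M).
Proof.
move=> A1 AV AA sM tM; split; first exact: (subset_mulsetl (subgroup1 sM)).
- move=> _ _ [a Aa [m Mm <-]] [b Ab [n Mn <-]].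
  have [c Ac [k Mk E]] := AA _ (mulsetM Aa Ab).
  have -> : a * m * (b * n) = c * (k * (m ^ b * n)).
    by rewrite [RHS]mulgA E conjgE !mulgA mulgK.
  apply: mulsetM => //; do 2!apply: subgroupM => //; exact: conj_stableJ Ab.
- move=> _ [a Aa [m Mm <-]].
  have -> : (a * m)^-1 = a^-1 * m^-1 ^ a^-1.
    by rewrite conjgE invgK invgM !mulgA mulVg mul1g.
  apply: mulsetM; first exact: AV.
  by apply: conj_stableJ (AV _ Aa) => //; exact: subgroupV.
Qed.

Lemma subgroup_mulset A M : is_subgroup A -> is_subgroup M ->
  conj_stable A M -> is_subgroup (mulset A M).
Proof.
move=> sA sM; apply: subgroup_mulset_mod => //.
- exact: subgroup1.
- by move=> a; exact: subgroupV.
- move=> _ [a Aa [b Ab <-]]; apply: subset_mulsetl; first exact: subgroup1.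
  exact: subgroupM.
Qed.

Lemma mulset_invg T A M x : (forall a, A a -> A a^-1) -> is_subgroup M ->
  conj_stable T M -> T x -> mulset A M x -> mulset A M x^-1.
Proof.
move=> AV sM TM Tx [a Aa [m Mm E]].
have -> : x^-1 = a^-1 * m^-1 ^ x^-1.
  by rewrite -E conjgE invgK !mulgA mulgK mulVg mul1g.
by apply: mulsetM; [exact: AV|exact: (TM x _ Tx (subgroupV sM Mm)).2].
Qed.

Definition abelian_mod A H := forall x y, A x -> A y -> H [~ x, y].

Lemma abelian_modS A A' H H' : A' `<=` A -> H `<=` H' ->
  abelian_mod A H -> abelian_mod A' H'.
Proof. by move=> AA HH aA x y /AA Ax /AA Ay; apply: HH; exact: aA. Qed.

Lemma abelian_mod_conj_stable A H M : abelian_mod A H -> is_subgroup A ->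
  is_subgroup M -> H `<=` M -> M `<=` A -> conj_stable A M.
Proof.
move=> aA sA sM HM MA; apply: conj_stable_subgroup => // x g Mx Ag.
by rewrite conjg_mulR; apply: subgroupM => //; apply/HM/aA => //; exact: MA.
Qed.

Lemma abelian_mod_closure A H :
  closed H -> abelian_mod A H -> abelian_mod (closure A) H.
Proof.
move=> clH aA x y clAx clAy.
have cl z : continuous (fun t : G => [~ t, z]).
  by move=> t; apply: cvgRg; [exact: cvg_id|exact: cvg_cst].
have cr z : continuous (fun t : G => [~ z, t]).
  by move=> t; apply: cvgRg; [exact: cvg_cst|exact: cvg_id].
apply: (closure_subset_preimage (cl y) clH) clAx => {}x Ax.
by apply: (closure_subset_preimage (cr x) clH) clAy => {}y Ay; exact: aA.
Qed.

Definition stable_gen T X : set G :=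
  [set x | forall M, is_subgroup M -> conj_stable T M -> X `<=` M -> M x].

Lemma stable_gen_subgroup T X : is_subgroup (stable_gen T X).
Proof.
split; first by move=> M sM _ _; exact: subgroup1.
  by move=> x y gx gy M sM tM XM; apply: subgroupM => //; [exact: gx|exact: gy].
by move=> x gx M sM tM XM; apply: subgroupV => //; exact: gx.
Qed.

Lemma stable_gen_conj_stable T X : conj_stable T (stable_gen T X).
Proof.
by move=> g x Tg gx; split=> M sM tM XM; have [] := tM _ _ Tg (gx M sM tM XM).
Qed.

Lemma subset_stable_gen T X : X `<=` stable_gen T X.
Proof. by move=> x Xx M _ _; exact. Qed.

Lemma subset_stable_genl T X Y : X `<=` stable_gen T (X `|` Y).
Proof. by move=> x Xx; apply: subset_stable_gen; left. Qed.

Lemma subset_stable_genr T X Y : Y `<=` stable_gen T (X `|` Y).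
Proof. by move=> y Yy; apply: subset_stable_gen; right. Qed.

Lemma stable_gen_min T X M : is_subgroup M -> conj_stable T M -> X `<=` M ->
  stable_gen T X `<=` M.
Proof. by move=> sM tM XM x; exact. Qed.

Lemma stable_gen_subset T T' X Y : T `<=` T' -> X `<=` stable_gen T' Y ->
  stable_gen T X `<=` stable_gen T' Y.
Proof.
move=> TT' XY; apply: stable_gen_min => //; first exact: stable_gen_subgroup.
by apply: (conj_stableS TT'); exact: stable_gen_conj_stable.
Qed.

Lemma stable_genS T T' X Y : T `<=` T' -> X `<=` Y ->
  stable_gen T X `<=` stable_gen T' Y.
Proof.
move=> TT' XY; apply: stable_gen_subset => //.
by apply: subset_trans XY _; exact: subset_stable_gen.
Qed.

Lemma generated_subgroupE X : generated_subgroup X = stable_gen set0 X.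
Proof.
by apply/seteqP; split=> x gx M sM => [_|]; exact: gx.
Qed.

Lemma conj_stable_gen T M :
  conj_stable T M -> conj_stable (stable_gen set0 T) M.
Proof.
move=> tM g x gTg; move: g gTg x; apply: stable_gen_min => //; last first.
  by move=> g Tg x; exact: tM.
split.
- by move=> x; rewrite invg1 conjg1.
- move=> g h Pg Ph x Mx; rewrite invgM !conjgM; split.
    exact: (Ph _ (Pg _ Mx).1).1.
  exact: (Pg _ (Ph _ Mx).2).2.
- by move=> g Pg x Mx; rewrite invgK; case: (Pg x Mx).
Qed.

Lemma stable_gen_set1 z x :
  stable_gen set0 [set z] x -> exists n, x = z ^+ n \/ x = z ^- n.
Proof.
suff zz : stable_gen set0 [set z] `<=`
    [set z ^+ p.1 / z ^+ p.2 | p in [set: nat * nat]].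
  move=> /zz[[m n] _ <-] /=; have [nm|/ltnW mn] := leqP n m.
    by exists (m - n)%N; left; rewrite expgnFr.
  by exists (n - m)%N; right; rewrite expgnFr // invgM invgK.
have zC m n : z ^- m * z ^+ n = z ^+ n * z ^- m.
  by apply/commute_sym/commuteV/commuteX2.
apply: stable_gen_min => //; last first.
  by move=> _ ->; exists (1, 0)%N; rewrite ?invg1 ?mulg1.
split.
- by exists (0, 0)%N; rewrite // invg1 mulg1.
- move=> _ _ [[m n] _ <-] [[m' n'] _ <-] /=; exists (m + m', n' + n)%N => //=.
  by rewrite !expgnDr invgM !mulgA -[X in _ = X / _]mulgA zC !mulgA.
- by move=> _ [[m n] _ <-] /=; exists (n, m) => //=; rewrite invgM invgK.
Qed.

Lemma stable_gen_setU1 z M : is_subgroup M -> conj_stable [set z] M ->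
  stable_gen set0 (z |` M) `<=` mulset (stable_gen set0 [set z]) M.
Proof.
move=> sM zM; apply: stable_gen_min => //.
  apply: subgroup_mulset => //; first exact: stable_gen_subgroup.
  exact: conj_stable_gen.
move=> x [->|Mx].
  by apply: subset_mulsetl; [exact: subgroup1|exact: subset_stable_gen].
by apply: subset_mulsetr => //; exact: (subgroup1 (stable_gen_subgroup _ _)).
Qed.

End Subgroups.
#[local] Hint Resolve stable_gen_subgroup conj_stable0 : core.

Section CompactGeneration.
Variable G : topGroupType.
Implicit Types (x y z g : G) (A B D F H K M N S T V W X Y : set G).

(* [N / H] is generated by the conjugates of a compact set under the group
   generated by [T]; carrying [H] along avoids quotient groups. *)
Definition comp_gen_mod T H N :=
  exists W, [/\ compact W, W `<=` N & N `<=` stable_gen T (W `|` H)].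

Lemma comp_gen_modS T T' H H' N : T `<=` T' -> H `<=` H' ->
  comp_gen_mod T H N -> comp_gen_mod T' H' N.
Proof.
move=> TT' HH' [W [cW WN NW]]; exists W; split=> //.
by apply: subset_trans NW _; apply: stable_genS => //; exact: setUS.
Qed.

Lemma comp_gen_mod_trans T H M N : M `<=` N ->
  comp_gen_mod T M N -> comp_gen_mod T H M -> comp_gen_mod T H N.
Proof.
move=> MN [W [cW WN NW]] [W' [cW' W'M MW']]; exists (W `|` W').
split; first exact: compactU.
  by rewrite subUset; split=> //; exact: subset_trans MN.
apply: subset_trans NW _; apply: stable_gen_subset => // x [Wx|/MW'].
  by apply: subset_stable_gen; left; left.
by apply: stable_genS => // y [W'y|Hy]; [left; right|right].
Qed.

Lemma cocompact_of_subset_mulset K M N : closed N -> is_subgroup N ->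
  M `<=` N -> compact K -> N `<=` mulset K M -> cocompact_in M N.
Proof.
move=> clN sN MN cK NKM; exists (K `&` N); split; first exact: compact_closedI.
apply/seteqP; split=> [x Nx|_ [k [_ Nk] [m /MN Nm <-]]]; last exact: subgroupM.
have [k Kk [m Mm E]] := NKM _ Nx; exists k; last by exists m.
by split=> //; apply: (subgroup_cancelr sN (MN _ Mm)); rewrite E.
Qed.

Lemma cocompact_inS M M' N : closed N -> is_subgroup N ->
  M `<=` M' -> M' `<=` N -> cocompact_in M N -> cocompact_in M' N.
Proof.
move=> clN sN MM' M'N [K [cK NE]].
apply: (cocompact_of_subset_mulset clN sN M'N cK).
by rewrite {1}NE; exact: mulsetS.
Qed.

Lemma cocompact_comp_gen_mod T M N :
  is_subgroup M -> cocompact_in M N -> comp_gen_mod T M N.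
Proof.
move=> sM [K [cK ->]]; exists K; split=> //.
  exact: (subset_mulsetl (subgroup1 sM)).
move=> _ [k Kk [m Mm <-]].
by apply: (subgroupM (stable_gen_subgroup _ _)); apply: subset_stable_gen;
  [left|right].
Qed.

Lemma stable_gen0_subset_lmul X Y : Y 1 ->
  (forall x y, X x -> Y y -> Y (x * y) /\ Y (x^-1 * y)) ->
  stable_gen set0 X `<=` Y.
Proof.
move=> Y1 XY x gx; rewrite -[x]mulg1.
suff lmul : stable_gen set0 X `<=`
    [set u | forall y, Y y -> Y (u * y) /\ Y (u^-1 * y)].
  exact: (lmul x gx 1 Y1).1.
apply: stable_gen_min => // [|{gx}x Xx y]; last exact: XY.
split=> [y|u v Pu Pv y Yy|u Pu y Yy]; first by rewrite invg1 mul1g.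
- rewrite invgM -!mulgA; split; first exact: (Pu _ (Pv _ Yy).1).1.
  exact: (Pv _ (Pu _ Yy).2).2.
- by rewrite invgK; case: (Pu _ Yy).
Qed.

Lemma stable_gen0_subset_mulset H M S W : is_subgroup H -> is_subgroup M ->
  H `<=` M -> conj_stable S H -> S 1 ->
  (forall w s, symm W w -> S s -> mulset S M (w * s)) ->
  stable_gen set0 (W `|` H) `<=` mulset S M.
Proof.
move=> sH sM HM SH S1 WS; apply: stable_gen0_subset_lmul.
  exact: (subset_mulsetl (subgroup1 sM)).
have symmW w y : symm W w -> mulset S M y -> mulset S M (w * y).
  move=> Ww [s Ss [m Mm <-]]; rewrite mulgA.
  have [t St [n Mn <-]] := WS _ _ Ww Ss.
  by rewrite -mulgA; apply: mulsetM => //; exact: subgroupM.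
have lmulH h y : H h -> mulset S M y -> mulset S M (h * y).
  move=> Hh [s Ss [m Mm <-]]; rewrite mulgA (conjgC h) -mulgA.
  by apply: mulsetM => //; apply: subgroupM => //; exact/HM/(conj_stableJ SH).
move=> x y [Wx|Hx] SMy; split.
- by apply: symmW => //; left.
- by apply: symmW => //; right; exists x.
- exact: lmulH.
- by apply: lmulH => //; exact: subgroupV.
Qed.

Lemma comp_gen_mod_mulset T H M N : is_subgroup M -> is_subgroup N ->
  comp_gen_mod T H M -> comp_gen_mod T H N -> comp_gen_mod T H (mulset M N).
Proof.
move=> sM sN [W [cW WM MW]] [W' [cW' W'N NW']]; exists (W `|` W').
split; first exact: compactU.
  move=> x [/WM Mx|/W'N Nx]; first exact: (subset_mulsetl (subgroup1 sN)).
  exact: (subset_mulsetr (subgroup1 sM)).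
move=> _ [m /MW gm [n /NW' gn <-]].
apply: (subgroupM (stable_gen_subgroup _ _)).
  by apply: stable_genS gm => //; apply: setSU; exact: subsetUl.
by apply: stable_genS gn => //; apply: setSU; exact: subsetUr.
Qed.

Lemma ascending_stationary T H (L : nat -> set G) V :
  {homo L : m n / (m <= n)%N >-> m `<=` n} -> (forall n, is_subgroup (L n)) ->
  (forall n, conj_stable T (L n)) -> H `<=` L 0%N ->
  nbhs (1 : G) V -> V `&` \bigcup_n L n `<=` L 0%N ->
  comp_gen_mod T H (\bigcup_n L n) -> exists n0, forall n, L n `<=` L n0.
Proof.
move=> L_mono sL tL HL V1 VL [W [cW WL LW]].
have sLoo : is_subgroup (\bigcup_n L n) by exact: subgroup_bigcup.
have [F [fF FL WVF]] :=
  compact_subset_mulset cW (subset_trans WL (@subset_closure _ _)) V1.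
have [n0 _ /(_ n0 (leqnn n0)) FLn0] := near_finite_subset L_mono fF FL.
exists n0 => n; apply: subset_trans (bigcup_sup _) (subset_trans LW _) => //.
have L0n0 : L 0%N `<=` L n0 by exact: L_mono.
apply: stable_gen_min => // w [Ww|/HL/L0n0//].
have [v Vv [f Ff E]] := WVF _ Ww; rewrite -E.
apply: subgroupM => //; last exact: FLn0.
apply/L0n0/VL; split=> //; apply: (subgroup_cancelr sLoo (FL _ Ff)).
by rewrite E; exact: WL.
Qed.

Lemma compactly_generated_comp_gen_mod T H :
  compactly_generated G -> comp_gen_mod T H [set: G].
Proof.
move=> [K [cK]]; rewrite generated_subgroupE => genK; exists K; split=> //.
by rewrite -genK; apply: stable_genS => //; exact: subsetUl.
Qed.

Lemma compact_symmetric_nbhs : locally_compact_group G ->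
  exists V, [/\ compact V, nbhs (1 : G) V & forall x, V x -> V x^-1].
Proof.
move=> [_ /(_ 1)[V [V1 cV]]]; exists (symm V); split.
- exact: compact_symm.
- by apply: filterS V1; exact: symm_subset.
- exact: symmV.
Qed.

Hypothesis lcG : locally_compact_group G.

Lemma exists_finite_gen_cocompact D H N : closed N -> is_subgroup N ->
  is_subgroup H -> H `<=` N -> conj_stable N H -> comp_gen_mod set0 H N ->
  D `<=` N -> N `<=` closure D ->
  exists F, [/\ finite_set F, F `<=` D &
    cocompact_in (stable_gen set0 (F `|` H)) N].
Proof.
move=> clN sN sH HN NH [W [cW WN NW]] DN ND.
have [V [cV V1 _]] := compact_symmetric_nbhs lcG.
pose S := (V `&` N) `|` symm W.
have cS : compact S.
  by apply: compactU; [exact: compact_closedI|exact: compact_symm].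
have SN : S `<=` N.
  by rewrite subUset; split; [exact: subIsetr|exact: symm_subset_subgroup].
have SS_closure : mulset S S `<=` closure D.
  by move=> _ [s /SN Ns [t /SN Nt <-]]; apply: ND; exact: subgroupM.
have [F [fF FD SSF]] :=
  compact_subset_mulset (compact_mulset cS cS) SS_closure V1.
exists F; split=> //.
apply: (cocompact_of_subset_mulset clN sN _ cS).
  apply: stable_gen_min => //; rewrite subUset; split=> //.
  exact: subset_trans DN.
apply: subset_trans NW _; apply: stable_gen0_subset_mulset => //.
- exact: subset_stable_genr.
- exact: conj_stableS NH.
- by left; split; [exact: nbhs_singleton|exact: subgroup1].
move=> w s Ww Ss; have SSws : mulset S S (w * s) by apply: mulsetM => //; right.
have [v Vv [f Ff E]] := SSF _ SSws; rewrite -E.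
apply: mulsetM; last exact: subset_stable_genl.
left; split=> //; apply: (subgroup_cancelr sN (DN _ (FD _ Ff))).
by rewrite E; apply: subgroupM => //; apply: SN => //; right.
Qed.

Lemma exists_finite_stable_cocompact T D H N : compact T ->
  closed N -> is_subgroup N -> conj_stable T N -> comp_gen_mod T H N ->
  D `<=` N -> N `<=` closure D ->
  exists F, [/\ finite_set F, F `<=` D &
    forall M, is_subgroup M -> conj_stable (T `|` N) M -> M `<=` N ->
      F `|` H `<=` M -> cocompact_in M N].
Proof.
move=> cT clN sN TN [W [cW WN NW]] DN ND.
have [V [cV V1 Vsym]] := compact_symmetric_nbhs lcG.
pose U := V `&` N; have cU : compact U by exact: compact_closedI.
pose C := mulset U U `|` (W `|` [set x ^ g | x in U & g in symm T]).
have cC : compact C.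
  apply: compactU; first exact: compact_mulset.
  by apply: compactU => //; apply: compact_conjg => //; exact: compact_symm.
have CN : C `<=` N.
  move=> _ [[x [_ Nx] [y [_ Ny] <-]]|[/WN//|[x [_ Nx] [g Tg <-]]]].
    exact: subgroupM.
  by case: Tg => [|[{}g + <-]] => /TN /(_ Nx)[].
have [F [fF FD CF]] := compact_subset_mulset cC (subset_trans CN ND) V1.
exists F; split=> // M sM TNM MN; rewrite subUset => -[FM HM].
have CM c m : C c -> M m -> mulset U M (c * m).
  move=> Cc Mm; have [v Vv [f Ff E]] := CF _ Cc; rewrite -E -mulgA.
  apply: mulsetM; last by apply: subgroupM => //; exact: FM.
  split=> //; apply: (subgroup_cancelr sN (DN _ (FD _ Ff))).
  by rewrite E; exact: CN.
have U1 : U 1 by split; [exact: nbhs_singleton|exact: subgroup1].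
apply: (cocompact_of_subset_mulset clN sN MN cU).
apply: subset_trans NW _; apply: stable_gen_min.
- apply: subgroup_mulset_mod => //.
  + by move=> u [Vu Nu]; split; [exact: Vsym|exact: subgroupV].
  + by move=> x UUx; rewrite -[x]mulg1; apply: CM; [left|exact: subgroup1].
  + by apply: conj_stableS TNM => u [_ Nu]; right.
- move=> g _ Tg [u Uu [m Mm <-]]; rewrite !conjMg.
  have [Mmg MmVg] := TNM g m (or_introl Tg) Mm.
  split; apply: CM => //; right; right; exists u => //.
    by exists g => //; exact: symm_subset.
  by exists g^-1 => //; apply/symmV/symm_subset.
- move=> x [Wx|/HM Mx]; last exact: subset_mulsetr.
  by rewrite -[x]mulg1; apply: CM; [right; left|exact: subgroup1].
Qed.

End CompactGeneration.

Section PowersModuloSubgroup.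
Variables (G : topGroupType) (B : set G) (z : G).
Hypotheses (sB : is_subgroup B) (zB : conj_stable [set z] B).
Implicit Types (x : G) (K M N U V : set G) (m n : nat).

Local Notation adjoin := (stable_gen set0 (z |` B)).

Lemma adjoin_conj_stable : conj_stable adjoin B.
Proof.
apply: conj_stable_gen; apply: conj_stableU => //; exact: conj_stable_refl.
Qed.

Lemma adjoin_power n b : B b -> adjoin (z ^+ n * b).
Proof.
move=> Bb; apply: (subgroupM (stable_gen_subgroup _ _)).
  apply: (subgroupX _ (stable_gen_subgroup _ _)).
  by apply: subset_stable_gen; left.
by apply: subset_stable_gen; right.
Qed.

Definition return_times K : set nat := [set n | mulset K B (z ^+ n)].

Lemma return_times_recurrent K V m : compact K ->
  infinite_set (return_times K) -> nbhs (1 : G) V ->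
  exists2 n, (m < n)%N & return_times V n.
Proof.
move=> cK infK V1; have [U [U1 UV' UV]] := nbhs1_split V1.
have [F [fF _ KUF]] := compact_subset_mulset cK (@subset_closure _ K) U1.
pose Uf_times f := return_times (mulset U [set f]).
have [f [Ff inff]] : exists f, F f /\ infinite_set (Uf_times f).
  apply: contrapT => /forallNP finF; apply: infK.
  apply: (@sub_finite_set _ _ (\bigcup_(f in F) Uf_times f)).
    move=> n [k /KUF[u Uu [f Ff <-]] [b Bb E]]; exists f => //.
    by exists (u * f); [exact: mulsetM|exists b].
  apply: bigcup_finite => // f Ff.
  by apply: contrapT => inff; apply: (finF f).
have [p [_ [u Uu [_ -> <-]] [b Bb zp]]] := infinite_setN0 inff.
have [q [[_ [v Uv [_ -> <-]] [c Bc zq]] /negP]] :=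
  infinite_setN0 (infinite_setD inff (finite_II (p + m).+1)).
rewrite -leqNgt => pmq; exists (q - p)%N; first by rewrite ltn_subRL.
have zqp : z ^+ (q - p) = v / u * (c / b) ^ (u * f)^-1.
  rewrite expgnFr ?(leq_trans (leq_addr m p)) 1?ltnW // -zp -zq conjgE.
  by rewrite invgK !invgM !mulgA !mulgVK.
have ufE : u * f = z ^+ p / b by rewrite -zp mulgK.
rewrite /return_times /= zqp; apply: mulsetM.
  by apply: UV => //; exact: UV'.
apply: (adjoin_conj_stable _ _).2; last exact: subgroup_div.
by rewrite ufE; apply: adjoin_power; exact: subgroupV.
Qed.

Lemma return_times_bounded_gaps V : compact V -> nbhs (1 : G) V ->
  (forall U m, nbhs (1 : G) U -> exists2 n, (m < n)%N & return_times U n) ->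
  exists L, forall n, return_times V n ->
    exists i, [/\ (0 < i)%N, (i <= L)%N & return_times V (n + i)].
Proof.
move=> cV V1 recurrent; have [U [U1 _ UV]] := nbhs1_split V1.
pose P := [set z ^+ p.1 * p.2 | p in [set p : nat * G | B p.2]].
have cVP : compact (V `&` closure P).
  by apply: compact_closedI => //; exact: closed_closure.
have [F [fF FP VPF]] := compact_subset_mulset cVP (@subIsetr _ _ _) U1.
have [L _ FL] : \forall L \near \oo, forall f, F f ->
    exists i, [/\ (0 < i)%N, (i <= L)%N & mulset U B (f * z ^+ i)].
  apply: near_finite_forall => // f /FP[[j b] /= Bb <-].
  have [m jm [u Uu [c Bc E]]] := recurrent U j U1.
  exists (m - j)%N => // L mjL; exists (m - j)%N; split; rewrite ?subn_gt0 //.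
  rewrite -mulgA (conjgC b) mulgA -expgnDr subnKC 1?ltnW // -E -mulgA.
  by apply: mulsetM => //; apply: subgroupM => //; exact: conj_stableX zB _ _.
exists L => n [v Vv [b Bb E]].
have VPv : (V `&` closure P) v.
  split=> //; apply: subset_closure; exists (n, b^-1); first exact: subgroupV.
  by rewrite /= -E mulgK.
have [u Uu [f Ff uf]] := VPF _ VPv.
have [i [i_gt0 iL [w Uw [c Bc E']]]] := FL L (leqnn L) f Ff.
exists i; split=> //; have zni : z ^+ (n + i) = u * w * (c * b ^ (z ^+ i)).
  by rewrite expgnDr -E -uf -[RHS]mulgA [w * _]mulgA E' conjgE !mulgA mulgK.
rewrite /return_times /= zni; apply: mulsetM; first exact: UV.
by apply: subgroupM => //; exact: conj_stableX zB _ _.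
Qed.

Lemma powers_precompact K : locally_compact_group G -> compact K ->
  infinite_set (return_times K) ->
  exists2 K', compact K' & forall n, return_times K' n.
Proof.
move=> lcG cK infK; have [V [cV V1 _]] := compact_symmetric_nbhs lcG.
have [L gaps] := return_times_bounded_gaps cV V1
  (fun U m => return_times_recurrent m cK infK).
have return_near n : exists2 i, (i <= L)%N & return_times V (n + i).
  elim: n => [|n [[|i] iL] Vni].
  - exists 0%N; rewrite // /return_times /= -[_ ^+ _]mulg1.
    by apply: mulsetM; [exact: nbhs_singleton|exact: subgroup1].
  - rewrite addn0 in Vni; have [[|i] [// _ iL' Vi]] := gaps n Vni.
    by exists i; [exact: ltnW|rewrite addSnnS].
  - by exists i; [exact: ltnW|rewrite addSnnS].
exists (mulset [set z ^- i | i in `I_L.+1] V).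
  apply: compact_mulset => //; apply: finite_compact.
  by apply: finite_image; exact: finite_II.
move=> n; have [i iL [v Vv [b Bb E]]] := return_near n.
have zn : z ^+ n = z ^- i * v * b by rewrite -mulgA E addnC expgnDr mulKg.
by rewrite /return_times /= zn; do 2!apply: mulsetM => //; exists i.
Qed.

(* Weil's lemma on monothetic groups, applied to the closure of [<z> B / B]. *)
Lemma cocompact_or_finite_return_times : locally_compact_group G -> closed B ->
  cocompact_in B (closure adjoin) \/
  (forall K, compact K -> finite_set (return_times K)).
Proof.
move=> lcG clB; have [|/existsNP[K /not_implyP[cK infK]]] :=
  pselect (forall K, compact K -> finite_set (return_times K)); first by right.
left; have [K' cK' K'z] := powers_precompact lcG cK infK.
have [V [cV V1 _]] := compact_symmetric_nbhs lcG.
have adjoinBK : adjoin `<=` mulset (symm K') B.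
  move=> _ /(stable_gen_setU1 sB zB)[t /stable_gen_set1[n tE] [b Bb <-]].
  suff [k Kk [c Bc <-]] : mulset (symm K') B t.
    by rewrite -mulgA; apply: mulsetM => //; exact: subgroupM.
  have zn := mulsetS (@symm_subset _ K') (@subset_refl _ B) (K'z n).
  case: tE => -> //.
  apply: (mulset_invg (@symmV _ K') sB adjoin_conj_stable) zn.
  by rewrite -[z ^+ n]mulg1; apply: adjoin_power; exact: subgroup1.
apply: (cocompact_of_subset_mulset (K := mulset V (symm K'))).
- exact: closed_closure.
- exact/subgroup_closure/stable_gen_subgroup.
- apply: subset_trans (@subset_closure _ _); exact: subset_stable_genr.
- by apply: compact_mulset => //; exact: compact_symm.
- move=> x clx; have [d /adjoinBK KBd Vd] := closure_div_nbhs1 clx V1.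
  by rewrite -mulsetA -[x](mulgVK d); exact: mulsetM.
Qed.

Lemma cocompact_of_finite_return_times M N : closed B -> is_subgroup M ->
  conj_stable [set z] M -> M `<=` B -> B `<=` N ->
  cocompact_in (stable_gen set0 (z |` M)) N ->
  (forall K, compact K -> finite_set (return_times K)) -> cocompact_in M B.
Proof.
move=> clB sM zM MB BN [K [cK NE]] finite_returns.
pose Z := [set z ^+ n | n in return_times (symm K)].
have cZ : compact Z.
  by apply: finite_compact; apply/finite_image/finite_returns/compact_symm.
apply: (cocompact_of_subset_mulset (K := mulset K (symm Z))) => //.
  by apply: compact_mulset => //; exact: compact_symm.
move=> b Bb; have := BN _ Bb; rewrite NE.
move=> [k Kk [_ /(stable_gen_setU1 sM zM)[t gt [m Mm <-]] E]].
have [n tE] := stable_gen_set1 gt; rewrite -E mulgA.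
apply: mulsetM => //; apply: mulsetM => //.
have KBt : mulset (symm K) B t.
  have -> : t = k^-1 * (b / m) by rewrite -E !mulgA mulgK mulVg mul1g.
  apply: mulsetM; first exact/symmV/symm_subset.
  by apply: subgroup_div => //; exact: MB.
case: tE KBt => -> KBt; first by left; exists n.
right; exists (z ^+ n) => //; exists n => //.
rewrite /return_times /= -[z ^+ n]invgK.
apply: (mulset_invg (@symmV _ K) sB adjoin_conj_stable) KBt.
apply: (subgroupV (stable_gen_subgroup _ _)).
by rewrite -[z ^+ n]mulg1; apply: adjoin_power; exact: subgroup1.
Qed.

End PowersModuloSubgroup.

Section ClosedSubgroups.
Variable G : topGroupType.
Implicit Types (z : G) (A B E F H K M N W : set G).

(* Schreier's generators: with [N = K B] and [W] generating [N] modulo [H], the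
   elements of [K^-1 W K] lying in [B] generate [B] modulo [H]. *)
Lemma cocompact_subgroup_comp_gen_mod H B N : closed B ->
  is_subgroup H -> is_subgroup B -> is_subgroup N -> H `<=` B -> B `<=` N ->
  conj_stable N H -> comp_gen_mod set0 H N -> cocompact_in B N ->
  comp_gen_mod set0 H B.
Proof.
move=> clB sH sB sN HB BN NH [W [cW WN NW]] [K [cK NE]].
pose S := 1 |` K; have S1 : S 1 by left.
have cS : compact S by apply: compactU => //; exact: compact_set1.
have SN : S `<=` N.
  rewrite subUset; split; first exact: subgroup_sub1set.
  by rewrite NE; exact: (subset_mulsetl (subgroup1 sB)).
pose T := 1 |` symm W.
pose Y := mulset (mulset (symm S) T) S `&` B.
have cY : compact Y.
  apply: compact_closedI => //; do 2!apply: compact_mulset => //.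
    exact: compact_symm.
  by apply: compactU; [exact: compact_set1|exact: compact_symm].
exists Y; split=> //; first exact: subIsetr.
have MB : stable_gen set0 (Y `|` H) `<=` B.
  by apply: stable_gen_min => //; rewrite subUset; split=> // y [].
have NSM : N `<=` mulset S (stable_gen set0 (Y `|` H)).
  apply: subset_trans NW _; apply: stable_gen0_subset_mulset => //.
  - exact: subset_stable_genr.
  - exact: conj_stableS NH.
  move=> w s Ww Ss; have : N (w * s).
    apply: subgroupM => //; last exact: SN.
    exact: symm_subset_subgroup WN _ Ww.
  rewrite NE => -[k Kk [b Bb E]]; rewrite -E; apply: mulsetM; first by right.
  apply: subset_stable_genl; split=> //; have -> : b = k^-1 * w * s.
    by rewrite -mulgA -E mulKg.
  apply: mulsetM => //; apply: mulsetM; last by right.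
  by apply/symmV/symm_subset; right.
move=> b Bb; have [s Ss [m Mm E]] := NSM _ (BN _ Bb); rewrite -E.
apply: (subgroupM (stable_gen_subgroup _ _)) => //.
apply: subset_stable_genl; split.
  rewrite -[s]mul1g; apply: mulsetM => //.
  by apply: subset_mulsetl; left=> //; left.
by apply: (subgroup_cancelr sB (MB _ Mm)); rewrite E.
Qed.

Hypothesis lcG : locally_compact_group G.

(* By Weil's lemma [B] is cocompact in the closure of [<z> B], or else it has a
   cocompact subgroup [M] that is finitely generated modulo [H]. *)
Lemma comp_gen_mod_of_adjoin z H B : closed B ->
  is_subgroup H -> is_subgroup B -> H `<=` B ->
  abelian_mod (closure (stable_gen set0 (z |` B))) H ->
  comp_gen_mod set0 H (closure (stable_gen set0 (z |` B))) ->
  comp_gen_mod set0 H B.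
Proof.
set D := stable_gen _ _; set N := closure D.
move=> clB sH sB HB aN gN.
have sN : is_subgroup N by exact/subgroup_closure/stable_gen_subgroup.
have clN : closed N by exact: closed_closure.
have DN : D `<=` N by exact: subset_closure.
have Nz : [set z] `<=` N.
  by apply: subset_trans DN; exact: subset_stable_genl.
have BN : B `<=` N by apply: subset_trans DN; exact: subset_stable_genr.
have conjN M : is_subgroup M -> H `<=` M -> M `<=` N -> conj_stable N M.
  exact: abelian_mod_conj_stable.
have NH := conjN H sH (@subset_refl _ H) (subset_trans HB BN).
have zB : conj_stable [set z] B by apply: conj_stableS Nz _; exact: conjN.
have [|finite_returns] := cocompact_or_finite_return_times sB zB lcG clB.
  exact: cocompact_subgroup_comp_gen_mod gN.
have HN := subset_trans HB BN.
have [F [fF FD cocF]] :=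
  exists_finite_gen_cocompact lcG clN sN sH HN NH gN DN (@subset_refl _ _).
have [F' [fF' F'B FF']] :=
  finite_subset_mulset fF (subset_trans FD (stable_gen_setU1 sB zB)).
pose M := stable_gen set0 (F' `|` H).
have HM : H `<=` M by exact: subset_stable_genr.
have MB : M `<=` B by apply: stable_gen_min => //; rewrite subUset.
have sM : is_subgroup M by exact: stable_gen_subgroup.
have zM : conj_stable [set z] M.
  by apply: conj_stableS Nz _; apply: conjN => //; exact: subset_trans BN.
have gM : comp_gen_mod set0 H M.
  exists F'; split=> //; first exact: finite_compact.
  exact: subset_stable_genl.
apply: (comp_gen_mod_trans MB _ gM); apply: cocompact_comp_gen_mod => //.
apply: (cocompact_of_finite_return_times sB zB clB sM zM MB BN) => //.
apply: cocompact_inS cocF => //.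
  apply: stable_gen_subset => // f [/FF'[t gt [f' F'f' <-]]|/HM Mf].
    apply: (subgroupM (stable_gen_subgroup _ _)).
      by apply: stable_genS gt => //; left.
    by apply: subset_stable_gen; right; apply: subset_stable_gen; left.
  by apply: subset_stable_gen; right.
apply: stable_gen_min => //; rewrite subUset; split=> //.
exact: subset_trans BN.
Qed.

Lemma closed_subgroup_comp_gen_mod_finite E : finite_set E ->
  forall H A B, closed A -> closed B ->
  is_subgroup H -> is_subgroup A -> is_subgroup B -> H `<=` B -> B `<=` A ->
  abelian_mod A H -> E `<=` A ->
  cocompact_in (stable_gen set0 (E `|` H)) A -> comp_gen_mod set0 H B.
Proof.
move: E; apply: finite_set_ind => [|z E _ IH] H A B clA clB sH sA sB HB BA aA.
  move=> _ [K [cK AE]]; apply: cocompact_comp_gen_mod => //.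
  apply: (cocompact_of_subset_mulset clB sB HB cK).
  apply: subset_trans BA _; rewrite AE; apply: mulsetS => //.
  by rewrite set0U; exact: stable_gen_min.
rewrite subUset => -[zA EA] cocE; have HA := subset_trans HB BA.
have NA : closure (stable_gen set0 (z |` B)) `<=` A.
  by apply: closure_min => //; apply: stable_gen_min; rewrite ?subUset.
apply: (@comp_gen_mod_of_adjoin z) => //; first exact: abelian_modS aA.
pose Hz := stable_gen set0 (z |` H).
have HHz : H `<=` Hz by exact: subset_stable_genr.
have HzA : Hz `<=` A by apply: stable_gen_min; rewrite ?subUset.
have HzN : Hz `<=` closure (stable_gen set0 (z |` B)).
  apply: subset_trans (@subset_closure _ _).
  by apply: stable_genS => //; exact: setUS.
apply: (comp_gen_mod_trans HzN); last first.
  exists [set z]; split; [exact: compact_set1|exact: subset_stable_genl|].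
  by [].
apply: (IH Hz A) => //.
- exact: closed_closure.
- exact: stable_gen_subgroup.
- exact: subgroup_closure.
- exact: (abelian_modS (@subset_refl _ A) HHz aA).
- apply: cocompact_inS cocE => //.
    apply: stable_gen_subset => // x [[->|Ex]|/HHz Hx];
      apply: subset_stable_gen.
    + by right; apply: subset_stable_gen; left.
    + by left.
    + by right.
  by apply: stable_gen_min; rewrite ?subUset.
Qed.

Theorem closed_subgroup_comp_gen_mod H A B : closed A -> closed B ->
  is_subgroup H -> is_subgroup A -> is_subgroup B -> H `<=` B -> B `<=` A ->
  abelian_mod A H -> comp_gen_mod set0 H A -> comp_gen_mod set0 H B.
Proof.
move=> clA clB sH sA sB HB BA aA gA; have HA := subset_trans HB BA.
have [|E [fE EA cocE]] := exists_finite_gen_cocompact lcG clA sA sH HA _ gA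
  (@subset_refl _ A) (@subset_closure _ A).
  exact: abelian_mod_conj_stable aA sA sH _ _.
exact: closed_subgroup_comp_gen_mod_finite cocE.
Qed.

End ClosedSubgroups.

Section ClosedSubmodules.
Variables (G : topGroupType) (A H : set G).
Hypotheses (lcG : locally_compact_group G) (sA : is_subgroup A).
Hypotheses (nH : is_normal_subgroup H) (abGA : abelian_mod [set: G] A).
Hypothesis abAH : abelian_mod A H.
Implicit Types (x y g : G) (B C M N T V W X : set G) (m n k : nat).

(* Submodules of [A / H] over the group generated by [T], which acts on [A / H]
   by conjugation. *)
Definition submodule T M :=
  [/\ is_subgroup M, conj_stable T M, H `<=` M & M `<=` A].

Lemma normal_submodule T M :
  is_normal_subgroup M -> H `<=` M -> M `<=` A -> submodule T M.
Proof. by move=> nM; split=> //; [case: nM|exact: normal_conj_stable]. Qed.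

Lemma submoduleS T T' M : T `<=` T' -> submodule T' M -> submodule T M.
Proof. by move=> TT' [sM tM HM MA]; split=> //; exact: conj_stableS tM. Qed.

Lemma conjg_in_A x g : A x -> A (x ^ g).
Proof.
move=> Ax; have GA : conj_stable [set: G] A.
  exact: (abelian_mod_conj_stable abGA (subgroup_setT G)).
exact: (conj_stableJ GA).
Qed.

(* The action on [A / H] factors through the abelian group [G / A]. *)
Lemma conjgC_mod M x g h : is_subgroup M -> H `<=` M -> A x ->
  M (x ^ (g * h)) -> M (x ^ (h * g)).
Proof.
move=> sM HM Ax Mx; rewrite [h * g]commgC conjgM conjg_mulR.
by apply: subgroupM => //; apply/HM/abAH; [exact: conjg_in_A|exact: abGA].
Qed.

Lemma submodule_setI T M N :
  submodule T M -> submodule T N -> submodule T (M `&` N).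
Proof.
move=> [sM tM HM MA] [sN tN HN NA]; split.
- exact: subgroup_setI.
- exact: conj_stable_setI.
- by rewrite subsetI.
- by move=> x [/MA].
Qed.

Lemma submodule_mulset T M N :
  submodule T M -> submodule T N -> submodule T (mulset M N).
Proof.
move=> [sM tM HM MA] [sN tN HN NA]; split.
- apply: subgroup_mulset => //; apply: conj_stableS MA _.
  exact: abelian_mod_conj_stable abAH sA sN HN NA.
- exact: conj_stable_mulset.
- by apply: subset_trans HM _; exact: (subset_mulsetl (subgroup1 sN)).
- by move=> _ [m /MA Am [n /NA An <-]]; exact: subgroupM.
Qed.

Lemma submodule_conjg_preimage T M g :
  submodule T M -> submodule T [set x | M (x ^ g)].
Proof.
move=> [sM tM HM MA].
have preA x : M (x ^ g) -> A x.
  by move=> /MA /(conjg_in_A g^-1); rewrite conjgK.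
split=> //; last by move=> x Hx; apply: HM; exact: nH.2.
  split=> [|x y Mx My|x Mx] /=; first by rewrite conj1g; exact: subgroup1.
    by rewrite conjMg; exact: subgroupM.
  by rewrite conjVg; exact: subgroupV.
move=> h x Th /= Mx; have [Mh MVh] := tM _ _ Th Mx.
by split; rewrite -conjgM; apply: conjgC_mod; rewrite ?conjgM //; exact: preA.
Qed.

Lemma submodule_stable_gen T X :
  X `<=` A -> H `<=` A -> submodule T (stable_gen T (X `|` H)).
Proof.
move=> XA HA; split; first exact: stable_gen_subgroup.
- exact: stable_gen_conj_stable.
- exact: subset_stable_genr.
- apply: stable_gen_min => //; last by rewrite subUset.
  by move=> g x _ Ax; split; exact: conjg_in_A.
Qed.

Lemma submodule_bigcup T (M_ : nat -> set G) :
  {homo M_ : m n / (m <= n)%N >-> m `<=` n} ->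
  (forall n, submodule T (M_ n)) -> submodule T (\bigcup_n M_ n).
Proof.
move=> M_mono subM; split.
- by apply: subgroup_bigcup => // n; case: (subM n).
- move=> g x Tg [n _ Mx]; have [_ tM _ _] := subM n.
  by have [? ?] := tM _ _ Tg Mx; split; exists n.
- by case: (subM 0%N) => _ _ HM _ x /HM Mx; exists 0%N.
- by apply: bigcup_sub => n _; case: (subM n).
Qed.

Lemma comp_gen_mod_conjg_preimage T M g : submodule T M ->
  comp_gen_mod T H M -> comp_gen_mod T H [set x | M (x ^ g)].
Proof.
move=> subM [W [cW WM MW]]; have [_ _ HM MA] := subM.
pose W' := [set x ^ g^-1 | x in W].
have W'A : W' `<=` A by move=> _ [x /WM/MA Ax <-]; exact: conjg_in_A.
exists W'; split; first exact/compact_image/cW/conjg_continuous.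
  by move=> _ [x /WM Mx <-] /=; rewrite conjgKV.
have [sW' tW' HW' _] := submodule_conjg_preimage g^-1
  (submodule_stable_gen T W'A (subset_trans HM MA)).
move=> x /= /MW; rewrite -{2}[x](conjgK g); move: (x ^ g).
apply: stable_gen_min => // y [Wy|/HW'//].
by apply: subset_stable_gen; left; exists y.
Qed.

Section Polynomials.
Variables (T B0 : set G) (g : G).
Hypothesis subB0 : submodule T B0.

(* With the elements of [B0] as coefficients, the polynomials of degree at most
   [n] in the automorphism [x |-> x ^ g]. *)
Fixpoint poly_le n : set G :=
  if n is m.+1 then mulset (poly_le m) [set x | B0 (x ^ (g ^- n))] else B0.

Lemma submodule_poly_le n : submodule T (poly_le n).
Proof.
elim: n => [//|n subPn]; apply: submodule_mulset => //.
exact: submodule_conjg_preimage.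
Qed.

Lemma subgroup_poly_le n : is_subgroup (poly_le n).
Proof. by case: (submodule_poly_le n). Qed.

Lemma comp_gen_mod_poly_le n :
  comp_gen_mod T H B0 -> comp_gen_mod T H (poly_le n).
Proof.
move=> gB0; elim: n => [//|n gPn]; apply: comp_gen_mod_mulset => //.
- exact: subgroup_poly_le.
- by case: (submodule_conjg_preimage (g ^- n.+1) subB0).
- exact: comp_gen_mod_conjg_preimage.
Qed.

Lemma poly_leS n : poly_le n `<=` poly_le n.+1.
Proof.
by apply: subset_mulsetl; rewrite /= conj1g; case: subB0 => /subgroup1.
Qed.

Lemma poly_le_homo : {homo poly_le : m n / (m <= n)%N >-> m `<=` n}.
Proof. exact: subset_homo poly_leS. Qed.

Lemma monomial_poly_le n x : B0 x -> poly_le n (x ^ (g ^+ n)).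
Proof.
case: n => [|n] B0x; first by rewrite conjg1.
apply: subset_mulsetr; first exact: (subgroup1 (subgroup_poly_le _)).
by rewrite /= conjgK.
Qed.

Lemma poly_le_conjg n x : poly_le n x -> poly_le n.+1 (x ^ g).
Proof.
elim: n x => [|n IHn] x; first exact: (@monomial_poly_le 1).
move=> [y Py [u B0u <-]]; rewrite conjMg; apply: mulsetM; first exact: IHn.
by rewrite /= -conjgM [g ^+ n.+2]expgSr invgM mulVKg.
Qed.

Lemma poly_le_conjgX n k x :
  poly_le n x -> poly_le (n + k) (x ^ (g ^+ k)).
Proof.
move=> Px; elim: k => [|k IHk]; first by rewrite addn0 conjg1.
by rewrite addnS expgSr conjgM; exact: poly_le_conjg.
Qed.

Lemma poly_le_subset n B : is_subgroup B -> conj_stable (g |` T) B ->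
  B0 `<=` B -> poly_le n `<=` B.
Proof.
move=> sB tB B0B; elim: n => [//|n IHn] _ [x Px [y B0y <-]].
apply: subgroupM => //; first exact: IHn.
rewrite -[y](conjgKV (g ^+ n.+1)).
by apply: conj_stableX tB (B0B _ B0y) _; left.
Qed.

Definition laurent := [set x | exists n k, poly_le n (x ^ (g ^+ k))].

Lemma submodule_laurent : submodule (g |` T) laurent.
Proof.
have HP n : H `<=` poly_le n by case: (submodule_poly_le n).
have laurentA : laurent `<=` A.
  move=> x [n [k Px]]; have [_ _ _ PA] := submodule_poly_le n.
  by rewrite -[x](conjgK (g ^+ k)); exact/conjg_in_A/PA.
split=> //; last by move=> x Hx; exists 0%N, 0%N; apply: HP; exact: nH.2.
- split.
  + by exists 0%N, 0%N; apply: HP; rewrite conj1g; case: nH => /subgroup1.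
  + move=> x y [n [k Px]] [n' [k' Py]].
    exists (maxn (n + k') (n' + k))%N, (k + k')%N; rewrite conjMg.
    apply: (subgroupM (subgroup_poly_le _)).
      rewrite expgnDr conjgM; apply: (poly_le_homo (leq_maxl _ _)).
      exact: poly_le_conjgX.
    rewrite [(k + k')%N]addnC expgnDr conjgM.
    apply: (poly_le_homo (leq_maxr _ _)).
    exact: poly_le_conjgX.
  + move=> x [n [k Px]]; exists n, k; rewrite conjVg.
    exact: (subgroupV (subgroup_poly_le _)).
- move=> h x [->|Th] Lx; have [n [k Px]] := Lx.
    split; last by exists n, k.+1; rewrite -conjgM expgS mulKg.
    exists n.+1, k; rewrite -conjgM -expgS expgSr conjgM; exact: poly_le_conjg.
  have [sP tP _ _] := submodule_poly_le n; have [Ph PVh] := tP _ _ Th Px.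
  by split; exists n, k; rewrite -conjgM; apply: conjgC_mod (laurentA _ Lx) _;
    rewrite ?conjgM.
Qed.

Section LeadingCoefficients.
Variable C : set G.
Hypothesis subC : submodule (g |` T) C.

(* Shifted index: these are the leading coefficients in degree [n.+1]. *)
Definition lead_coef n :=
  B0 `&` [set a | mulset (poly_le n) C (a ^ (g ^+ n.+1))].

Lemma submodule_lead_coef n : submodule T (lead_coef n).
Proof.
apply: submodule_setI => //; apply: submodule_conjg_preimage.
apply: submodule_mulset; first exact: submodule_poly_le.
by apply: submoduleS subC; exact: subsetUr.
Qed.

Lemma lead_coef_homo : {homo lead_coef : m n / (m <= n)%N >-> m `<=` n}.
Proof.
apply: subset_homo => n a [B0a [x Px [c Cc E]]].
split=> //=; rewrite [g ^+ n.+2]expgSr conjgM -E conjMg.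
apply: mulsetM; first exact: poly_le_conjg.
by case: subC => _ tC _ _; apply: conj_stableJ tC Cc _; left.
Qed.

(* Division with remainder: the term of degree [n.+1] of an element of [C] is
   cancelled by a conjugate of an element of [C] of degree at most [n0.+1]. *)
Lemma setI_poly_le_subset X n0 : is_subgroup X -> conj_stable [set g] X ->
  C `&` poly_le n0.+1 `<=` X -> (forall n, lead_coef n `<=` lead_coef n0) ->
  forall n, C `&` poly_le n `<=` X.
Proof.
move=> sX gX low_degree stationary; have [sC tC _ _] := subC.
have low n : (n <= n0.+1)%N -> C `&` poly_le n `<=` X.
  by move=> /poly_le_homo Pn c [Cc /Pn Pc]; exact: low_degree.
elim=> [|n IHn] c [Cc Pc]; first by apply: (low 0%N).
have [nn0|/ltnW n0n] := leqP n n0; first by apply: (low n.+1).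
have [x Px [y /= B0y E]] := Pc; set a := y ^ _ in B0y.
have ya : a ^ (g ^+ n.+1) = y by rewrite conjgKV.
have [_ [y0 Py0 [c0 Cc0 E0]]] : lead_coef n0 a.
  apply: (stationary n); split=> //=; rewrite ya -[y](mulKg x) E.
  by apply: mulsetM => //; exact: (subgroupV (subgroup_poly_le _)).
have Xc0 : X c0.
  apply: low_degree; split=> //.
  apply: (subgroup_cancell (subgroup_poly_le _) (poly_leS Py0)).
  by rewrite E0; exact: monomial_poly_le.
pose shift := g ^+ (n - n0).
have Cc0' : C (c0 ^ shift) by apply: conj_stableX tC Cc0 _; left.
have Xc0' : X (c0 ^ shift) by exact: conj_stableX gX Xc0 _.
have cE : c = x * y0 ^ shift * c0 ^ shift.
  rewrite -mulgA -conjMg E0 -conjgM -expgnDr -E -ya; congr (_ * _ ^ (_ ^+ _)).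
  by rewrite addSn subnKC.
rewrite cE; apply: subgroupM => //; apply: IHn; split.
  by apply: (subgroup_cancelr sC Cc0'); rewrite -cE.
apply: (subgroupM (subgroup_poly_le _)) => //.
by rewrite -(subnKC n0n); exact: poly_le_conjgX.
Qed.

End LeadingCoefficients.
End Polynomials.

Definition noetherian T := forall B C, submodule T B -> submodule T C ->
  closed B -> closed C -> C `<=` B -> comp_gen_mod T H B -> comp_gen_mod T H C.

Lemma noetherian0 : noetherian set0.
Proof.
move=> B C [sB _ HB BA] [sC _ HC _] clB clC CB.
apply: closed_subgroup_comp_gen_mod => //; first by case: nH.
exact: abelian_modS BA (@subset_refl _ H) abAH.
Qed.

Lemma lead_coef_stationary T g B0 B C V : noetherian T ->
  submodule T B0 -> comp_gen_mod T H B0 ->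
  submodule (g |` T) B -> closed B -> B0 `<=` B -> submodule (g |` T) C ->
  nbhs (1 : G) V -> V `&` B `<=` B0 ->
  exists n0, forall n, lead_coef B0 g C n `<=` lead_coef B0 g C n0.
Proof.
move=> noethT subB0 gB0 [sB tB _ _] clB B0B subC V1 VB0.
set L := lead_coef B0 g C.
have subL n : submodule T (L n) by exact: submodule_lead_coef.
have L_mono := lead_coef_homo subB0 subC.
have subLoo : submodule T (\bigcup_n L n) by exact: submodule_bigcup.
have LooB0 : \bigcup_n L n `<=` B0 by apply: bigcup_sub => n _ x [].
pose V' := V `&` [set x | V (x ^ g)].
have V'1 : nbhs (1 : G) V' by apply: filterI => //; exact: nbhs1_conjg.
have V'L0 : V' `&` B `<=` L 0%N.
  move=> x [[Vx Vxg] Bx]; split; first exact: VB0.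
  apply: subset_mulsetl; first by case: subC => /subgroup1.
  by apply: VB0; split=> //; apply: conj_stableJ tB Bx _; left.
have V'L0' : V' `&` \bigcup_n L n `<=` L 0%N.
  by move=> x [V'x /LooB0/B0B Bx]; exact: V'L0.
have closedB0 : closed B0.
  by case: subB0 => sB0 _ _ _; exact: relatively_open_subgroup_closed VB0.
have closedLoo : closed (\bigcup_n L n).
  case: subLoo => sLoo _ _ _.
  apply: (relatively_open_subgroup_closed clB sB sLoo _ V'1).
    exact: subset_trans B0B.
  by move=> x /V'L0 Lx; exists 0%N.
apply: ascending_stationary V'1 V'L0' (noethT _ _ _ _ _ _ _ gB0) => //.
- by move=> n; case: (subL n).
- by move=> n; case: (subL n).
- by case: (subL 0%N).
Qed.

Lemma exists_open_generating_submodule T T' B : T `<=` T' ->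
  submodule T' B -> closed B -> comp_gen_mod T' H B ->
  exists B0, [/\ submodule T B0, comp_gen_mod T H B0, B0 `<=` B,
    B `<=` stable_gen T' B0 & exists2 V, nbhs (1 : G) V & V `&` B `<=` B0].
Proof.
move=> TT' subB clB [W [cW WB BW]]; have [sB tB HB BA] := subB.
have [V [cV V1 _]] := compact_symmetric_nbhs lcG.
pose W' := W `|` (V `&` B); pose B0 := stable_gen T (W' `|` H).
have W'B : W' `<=` B by rewrite subUset; split=> //; exact: subIsetr.
have W'HB0 : W' `|` H `<=` B0 by exact: subset_stable_gen.
have W'B0 : W' `<=` B0 by apply: subset_trans W'HB0; exact: subsetUl.
exists B0; split.
- by apply: submodule_stable_gen; exact: subset_trans BA.
- by exists W'; split=> //; apply: compactU => //; exact: compact_closedI.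
- apply: stable_gen_min; rewrite ?subUset //; exact: conj_stableS tB.
- apply: subset_trans BW _; apply: stable_genS => //.
  by apply: subset_trans W'HB0; apply: setSU; exact: subsetUl.
- by exists V => //; apply: subset_trans W'B0; exact: subsetUr.
Qed.

Lemma noetherian_setU1 T g : noetherian T -> noetherian (g |` T).
Proof.
move=> noethT B C subB subC clB clC CB gB.
have T_gT : T `<=` g |` T by exact: subsetUr.
have [B0 [subB0 gB0 B0B BB0 [V V1 VB0]]] :=
  exists_open_generating_submodule T_gT subB clB gB.
have [n0 stationary] :=
  lead_coef_stationary noethT subB0 gB0 subB clB B0B subC V1 VB0.
have [[sB tB _ _] [_ tC _ _]] := (subB, subC).
pose P := poly_le B0 g n0.+1; have subP : submodule T P.
  exact: submodule_poly_le.
have clP : closed P.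
  apply: (relatively_open_subgroup_closed clB sB _ _ V1).
  - by case: subP.
  - exact: poly_le_subset tB B0B.
  - by apply: subset_trans VB0 _; exact: (@poly_le_homo _ _ _ subB0 0%N).
have [W [cW WCP CPW]] : comp_gen_mod T H (C `&` P).
  apply: (noethT P _ subP _ clP (closedI clC clP)); last 2 first.
  - exact: subIsetr.
  - exact: comp_gen_mod_poly_le.
  by apply: submodule_setI => //; exact: submoduleS subC.
exists W; split=> //; first by move=> w /WCP[].
set X := stable_gen _ _; have gX : conj_stable [set g] X.
  by apply: conj_stableS (@stable_gen_conj_stable _ _ _) => x ->; left.
have CX n : C `&` poly_le B0 g n `<=` X.
  apply: (setI_poly_le_subset subB0 subC) stationary n => //.
    exact: stable_gen_subgroup.
  by apply: subset_trans CPW _; exact: stable_genS.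
have Blaurent : B `<=` laurent B0 g.
  have [sL tL _ _] := submodule_laurent g subB0.
  apply: subset_trans BB0 _; apply: stable_gen_min => // x B0x.
  by exists 0%N, 0%N; rewrite conjg1.
move=> c Cc; have [n [k Pc]] := Blaurent _ (CB _ Cc).
apply: (conj_stableXV gX (erefl g) (CX n _ _)); split; last exact: Pc.
by apply: conj_stableX tC Cc _; left.
Qed.

Theorem noetherian_finite T : finite_set T -> noetherian T.
Proof.
by move: T; apply: finite_set_ind => [|g T _]; [exact: noetherian0|
  exact: noetherian_setU1].
Qed.

End ClosedSubmodules.

Section CommutatorSubgroup.
Variable G : topGroupType.
Implicit Types (x y g : G) (K M N S T V : set G).

Lemma abelian_mod_setT_normal M :
  is_subgroup M -> abelian_mod [set: G] M -> is_normal_subgroup M.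
Proof.
move=> sM abGM; split=> // x g Mx; rewrite conjg_mulR.
by apply: subgroupM => //; exact: abGM.
Qed.

Lemma abelian_mod_gen K M : is_normal_subgroup M ->
  abelian_mod K M -> abelian_mod (stable_gen set0 K) M.
Proof.
move=> [sM nM] abKM.
have centralizer_subgroup y : is_subgroup [set x | M [~ x, y]].
  split=> [|u v Mu Mv|u Mu] /=; first by rewrite comm1g; exact: subgroup1.
    by rewrite commMgJ; apply: subgroupM => //; exact: nM.
  by rewrite commVgJ; apply: nM; exact: subgroupV.
have gK y : (forall x, K x -> M [~ x, y]) ->
    forall x, stable_gen set0 K x -> M [~ x, y].
  by move=> KM; apply: (stable_gen_min (centralizer_subgroup y)).
move=> x y gx gy; apply: (gK y _ x gx) => {gx}x Kx.
rewrite -invgR; apply: subgroupV => //; apply: (gK x _ y gy) => {gy}y Ky.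
exact: abKM.
Qed.

Definition normal_core M : set G := [set x | forall g, M (x ^ g)].

Lemma normal_core_normal M :
  is_subgroup M -> is_normal_subgroup (normal_core M).
Proof.
move=> sM; split; last by move=> x g Mx h; rewrite -conjgM.
split=> [g|x y Mx My g|x Mx g]; first by rewrite conj1g; exact: subgroup1.
  by rewrite conjMg; exact: subgroupM.
by rewrite conjVg; exact: subgroupV.
Qed.

Lemma abelian_mod_mulset M N : is_normal_subgroup N ->
  abelian_mod M [set 1] -> abelian_mod [set: G] M ->
  abelian_mod (mulset N M) (N `&` M).
Proof.
move=> [sN nN] abM abGM.
have NR x y : N x -> N [~ x, y].
  move=> Nx; rewrite commgEl.
  by apply: subgroupM; [|exact: subgroupV|exact: nN].
move=> _ _ [x Nx [a Ma <-]] [y Ny [b Mb <-]]; split; last exact: abGM.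
rewrite commMgJ (commgMJ a) (abM a b Ma Mb) mul1g.
apply: subgroupM => //; first exact/nN/NR.
by apply: nN; rewrite -invgR; apply: subgroupV => //; exact: NR.
Qed.

Definition closed_derived : set G := closure (@derived_subgroup G).

Lemma subgroup_closed_derived : is_subgroup closed_derived.
Proof.
by apply: subgroup_closure; rewrite /derived_subgroup generated_subgroupE.
Qed.

Lemma abelian_mod_closed_derived : abelian_mod [set: G] closed_derived.
Proof.
move=> x y _ _; apply: subset_closure.
by rewrite /derived_subgroup generated_subgroupE; apply: subset_stable_gen;
  exists x => //; exists y.
Qed.

Lemma normal_closed_derived : is_normal_subgroup closed_derived.
Proof.
apply: abelian_mod_setT_normal; first exact: subgroup_closed_derived.
exact: abelian_mod_closed_derived.
Qed.

Lemma closed_derived_min M : closed M -> is_subgroup M ->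
  abelian_mod [set: G] M -> closed_derived `<=` M.
Proof.
move=> clM sM abGM; apply: closure_min => //.
rewrite /derived_subgroup generated_subgroupE; apply: stable_gen_min => //.
by move=> _ [x _ [y _ <-]]; exact: abGM.
Qed.

Lemma metabelian_closed_derived : hausdorff_space G -> metabelian G ->
  abelian_mod closed_derived [set 1].
Proof.
move=> T2G metaG; apply: abelian_mod_closure => [|x y dx dy /=].
  by apply: compact_closed => //; exact: compact_set1.
by apply/eqP/commgP; exact: metaG.
Qed.

(* Conjugating [~ K, K] by [S], where [G = S <T>], accounts for conjugation by
   all of [G]. *)
Lemma closed_derived_comp_gen_mod T :
  locally_compact_group G -> compactly_generated G ->
  cocompact_in (stable_gen set0 T) [set: G] ->
  comp_gen_mod T [set 1] closed_derived.
Proof.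
move=> lcG [K [cK genK]] [S [cS GE]]; set A := closed_derived.
rewrite generated_subgroupE in genK.
have [V [cV V1 _]] := compact_symmetric_nbhs lcG.
have clA : closed A by exact: closed_closure.
have [sA nA] := normal_closed_derived.
pose R := [set [~ x, y] | x in K & y in K].
pose W := [set r ^ s | r in R & s in S] `|` (V `&` A).
have WA : W `<=` A.
  rewrite subUset; split; last exact: subIsetr.
  move=> _ [_ [x _ [y _ <-]] [s _ <-]]; apply: nA.
  exact: abelian_mod_closed_derived.
exists W; split=> //.
  apply: compactU; last exact: compact_closedI.
  by apply: compact_conjg => //; exact: compact_commg.
set M := stable_gen _ _; have sM : is_subgroup M by exact: stable_gen_subgroup.
have MA : M `<=` A.
  apply: stable_gen_min => //; first exact: normal_conj_stable.
  by rewrite subUset; split=> //; exact: subgroup_sub1set.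
have WM : W `<=` M by exact: subset_stable_genl.
apply: closed_derived_min => //.
  apply: (relatively_open_subgroup_closed clA sA sM MA V1).
  by apply: subset_trans WM; exact: subsetUr.
suff abK : abelian_mod K (normal_core M).
  rewrite -genK => x y gx gy; rewrite -[[~ x, y]]conjg1.
  exact: (abelian_mod_gen (normal_core_normal sM) abK gx gy).
move=> x y Kx Ky g; have : [set: G] g by [].
rewrite GE => -[s Ss [t gt <-]]; rewrite conjgM.
apply: conj_stableJ (conj_stable_gen (@stable_gen_conj_stable _ T _)) _ gt.
apply: WM; left; exists [~ x, y]; last by exists s.
by exists x => //; exists y.
Qed.

End CommutatorSubgroup.

Section Metabelian.
Variable G : topGroupType.
Hypotheses (lcG : locally_compact_group G) (cgG : compactly_generated G).
Hypothesis metaG : metabelian G.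
Implicit Types (N T : set G).

Local Notation A := (@closed_derived G).

Lemma exists_finite_comp_gen_closed_derived :
  exists2 T, finite_set T & comp_gen_mod T [set 1] A.
Proof.
have [T [fT _ cocT]] := exists_finite_gen_cocompact lcG (@closedT _)
  (subgroup_setT G) (subgroup_set1 G) (@subsetT _ _)
  (normal_conj_stable (normal_set1 G))
  (compactly_generated_comp_gen_mod set0 [set 1] cgG)
  (@subset_refl _ _) (@subset_closure _ _).
exists T => //; apply: closed_derived_comp_gen_mod => //.
apply: cocompact_inS cocT => //.
apply: stable_gen_subset => //; rewrite subUset; split.
  exact: subset_stable_gen.
by apply: subgroup_sub1set.
Qed.

Lemma comp_gen_mod_above_closed_derived N :
  closed N -> is_subgroup N -> A `<=` N -> comp_gen_mod set0 A N.
Proof.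
move=> clN sN AN.
apply: (closed_subgroup_comp_gen_mod lcG (@closedT _) clN) => //.
- exact: subgroup_closed_derived.
- exact: abelian_mod_closed_derived.
- exact: compactly_generated_comp_gen_mod.
Qed.

Lemma comp_gen_mod_setI_closed_derived T N : finite_set T ->
  comp_gen_mod T [set 1] A -> is_closed_normal_subgroup N ->
  comp_gen_mod T [set 1] (N `&` A).
Proof.
move=> fT gA [nN clN]; have clA : closed A by exact: closed_closure.
have [nA sA] := (@normal_closed_derived G, @subgroup_closed_derived G).
have nNA : is_normal_subgroup (N `&` A) by exact: normal_setI.
have abA := metabelian_closed_derived lcG.1 metaG.
have noethT := noetherian_finite lcG sA (normal_set1 G)
  (@abelian_mod_closed_derived G) abA fT.
apply: noethT gA => //.
- by apply: normal_submodule => //; exact: subgroup_sub1set.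
- apply: normal_submodule => //.
  by apply: subgroup_sub1set; case: nNA.
- exact: closedI.
Qed.

(* [N / (N :&: A)] is a submodule of the abelian group
   [closure (N A) / (N :&: A)]. *)
Lemma comp_gen_mod_over_setI_closed_derived T N : finite_set T ->
  comp_gen_mod T [set 1] A -> is_closed_normal_subgroup N ->
  comp_gen_mod T (N `&` A) N.
Proof.
move=> fT gA [nN clN]; have [sN _] := nN.
have [nA sA] := (@normal_closed_derived G, @subgroup_closed_derived G).
have abA := metabelian_closed_derived lcG.1 metaG.
have abGA := @abelian_mod_closed_derived G.
have clA : closed A by exact: closed_closure.
pose H := N `&` A; have nH : is_normal_subgroup H by exact: normal_setI.
pose NA := closure (mulset N A); have clNA : closed NA by exact: closed_closure.
have sNA : is_subgroup NA.
  by apply/subgroup_closure/subgroup_mulset => //; exact: normal_conj_stable.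
have N_NA : N `<=` NA.
  apply: subset_trans (@subset_closure G _).
  exact: (subset_mulsetl (subgroup1 sA)).
have A_NA : A `<=` NA.
  apply: subset_trans (@subset_closure G _).
  exact: (subset_mulsetr (subgroup1 sN)).
have abGNA : abelian_mod [set: G] NA.
  exact: (abelian_modS (@subset_refl _ _) A_NA abGA).
have abNA : abelian_mod NA H.
  by apply: abelian_mod_closure; [exact: closedI|exact: abelian_mod_mulset].
have gNA : comp_gen_mod T H NA.
  apply: (comp_gen_mod_trans A_NA).
    exact: comp_gen_modS (comp_gen_mod_above_closed_derived clNA sNA A_NA).
  by apply: comp_gen_modS gA => //; apply: subgroup_sub1set; case: nH.
apply: (noetherian_finite lcG sNA nH abGNA abNA fT) gNA => //.
- apply: normal_submodule => //; first exact: abelian_mod_setT_normal.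
  by apply: subset_trans N_NA; exact: subIsetl.
- by apply: normal_submodule => //; exact: subIsetl.
Qed.

Lemma closed_normal_comp_gen_mod N : is_closed_normal_subgroup N ->
  exists2 T, finite_set T & comp_gen_mod T [set 1] N.
Proof.
move=> nN; have [T fT gA] := exists_finite_comp_gen_closed_derived.
exists T => //; apply: (@comp_gen_mod_trans _ _ _ (N `&` A)).
- exact: subIsetl.
- exact: comp_gen_mod_over_setI_closed_derived.
- exact: comp_gen_mod_setI_closed_derived.
Qed.

End Metabelian.

Theorem mainTheorem15 (G : topGroupType) (Nseq : nat -> set G) :
  locally_compact_group G ->
  compactly_generated G ->
  metabelian G ->
  (forall n, is_closed_normal_subgroup (Nseq n)) ->
  (forall n, Nseq n `<=` Nseq n.+1) ->
  exists n0 : nat, forall n, (n0 <= n)%N ->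
    cocompact_in (Nseq n) (closure (\bigcup_k Nseq k)).
Proof.
move=> lcG cgG metaG nN NS; set D := \bigcup_k Nseq k; set N := closure D.
have N_mono := subset_homo NS.
have nD : is_normal_subgroup D.
  split; first by apply: subgroup_bigcup => // n; case: (nN n) => -[].
  by move=> x g [n _ Nx]; exists n => //; exact: (nN n).1.2.
have clN : closed N by exact: closed_closure.
have nclN : is_normal_subgroup N by exact: closure_normal_subgroup.
have [T fT gN] := closed_normal_comp_gen_mod lcG cgG metaG (conj nclN clN).
have [F [fF FD cocF]] := exists_finite_stable_cocompact lcG (finite_compact fT)
  clN nclN.1 (normal_conj_stable nclN) gN (@subset_closure _ D)
  (@subset_refl _ N).
have [n0 _ FNn0] := near_finite_subset N_mono fF FD.
exists n0 => n n0n; have sNn : is_subgroup (Nseq n) by case: (nN n) => -[].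
apply: cocF => //; first by apply: normal_conj_stable; case: (nN n).
  by move=> x Nx; apply: subset_closure; exists n.
by rewrite subUset; split; [exact: FNn0|exact: subgroup_sub1set].
Qed.
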